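(* For every positive integer $n$, the generating function $f^{[n]}(t)=\sum_{k\ge 0} b^{[n]}_k t^k$ of the positive singular braid monoid $SB_n^+$, where $b^{[n]}_k$ is the number of elements of $SB_n^+$ of length $k$, is rational; that is, the power series $f^{[n]}(t)$ is the expansion at $t=0$ of a rational function of $t$.
   Context: The positive singular braid monoid $SB_n^+$ on $n$ strands is the monoid given by the generators $\sigma_i, x_i$, $i=1,\dots,n-1$, and the relations (for all indices for which they make sense) $$\sigma_i\sigma_j=\sigma_j\sigma_i \ \text{ if } |i-j|>1,$$ $$x_ix_j=x_jx_i \ \text{ if } |i-j|>1,$$ $$x_i\sigma_j=\sigma_jx_i \ \text{ if } |i-j|\neq 1,$$ $$\sigma_i\sigma_{i+1}\sigma_i=\sigma_{i+1}\sigma_i\sigma_{i+1},$$ $$\sigma_i\sigma_{i+1}x_i=x_{i+1}\sigma_i\sigma_{i+1},$$ $$\sigma_{i+1}\sigma_ix_{i+1}=x_i\sigma_{i+1}\sigma_i.$$ All relations are between words of equal length, so each element has a well-defined length: the number of letters in any word in the generators $\sigma_i,x_i$ representing it (the identity has length $0$). *)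

(* Defs.v *)
From HB Require Import structures.
From mathcomp Require Import all_boot all_order all_algebra.
From mathcomp Require Import finmap boolp classical_sets cardinality.

Set Implicit Arguments.
Unset Strict Implicit.
Unset Printing Implicit Defensive.

Import GRing.Theory.

Local Open Scope quotient_scope.

(* The n - 1 indices 1, ..., n - 1 of the generators are shifted to 'I_n.-1;
   the defining relations are invariant under this shift. *)
Variant sb_gen (n : nat) := Sigma of 'I_n.-1 | Sing of 'I_n.-1.

Arguments Sigma {n}.
Arguments Sing {n}.

Definition sum_of_sb_gen n (g : sb_gen n) : 'I_n.-1 + 'I_n.-1 :=
  match g with Sigma i => inl i | Sing i => inr i end.

Definition sb_gen_of_sum n (s : 'I_n.-1 + 'I_n.-1) : sb_gen n :=
  match s with inl i => Sigma i | inr i => Sing i end.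

Fact sum_of_sb_genK n : cancel (@sum_of_sb_gen n) (@sb_gen_of_sum n).
Proof. by case. Qed.

HB.instance Definition _ n := Finite.copy (sb_gen n) (can_type (@sum_of_sb_genK n)).

Notation sb_word n := (seq (sb_gen n)).

Inductive sb_rel (n : nat) : sb_word n -> sb_word n -> Prop :=
| sb_rel_sigma_sigma (i j : 'I_n.-1) : (1 < `|i - j|)%N ->
    sb_rel [:: Sigma i; Sigma j] [:: Sigma j; Sigma i]
| sb_rel_sing_sing (i j : 'I_n.-1) : (1 < `|i - j|)%N ->
    sb_rel [:: Sing i; Sing j] [:: Sing j; Sing i]
| sb_rel_sing_sigma (i j : 'I_n.-1) : (`|i - j| != 1)%N ->
    sb_rel [:: Sing i; Sigma j] [:: Sigma j; Sing i]
| sb_rel_braid (i j : 'I_n.-1) : j = i.+1 :> nat ->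
    sb_rel [:: Sigma i; Sigma j; Sigma i] [:: Sigma j; Sigma i; Sigma j]
| sb_rel_sing_up (i j : 'I_n.-1) : j = i.+1 :> nat ->
    sb_rel [:: Sigma i; Sigma j; Sing i] [:: Sing j; Sigma i; Sigma j]
| sb_rel_sing_down (i j : 'I_n.-1) : j = i.+1 :> nat ->
    sb_rel [:: Sigma j; Sigma i; Sing j] [:: Sing i; Sigma j; Sigma i].

Inductive sb_cong (n : nat) : sb_word n -> sb_word n -> Prop :=
| sb_cong_step (u v w w' : sb_word n) :
    sb_rel w w' -> sb_cong (u ++ w ++ v) (u ++ w' ++ v)
| sb_cong_refl (w : sb_word n) : sb_cong w w
| sb_cong_sym (w w' : sb_word n) : sb_cong w w' -> sb_cong w' w
| sb_cong_trans (w1 w2 w3 : sb_word n) :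
    sb_cong w1 w2 -> sb_cong w2 w3 -> sb_cong w1 w3.

Lemma sb_cong_size n (u v : sb_word n) : sb_cong u v -> size u = size v.
Proof.
elim=> {u v} [u v w w' Hw|//|//|w1 w2 w3 _ -> _ -> //].
by rewrite !size_cat; case: Hw.
Qed.

Lemma sb_cong_cat n (u u' v v' : sb_word n) :
  sb_cong u u' -> sb_cong v v' -> sb_cong (u ++ v) (u' ++ v').
Proof.
move=> Hu Hv; apply: (@sb_cong_trans _ _ (u' ++ v)).
- elim: Hu => {u u' v' Hv} [u x w w' Hw|w|w w' _ IH|w1 w2 w3 _ IH1 _ IH2].
  + by rewrite -!catA; apply: sb_cong_step.
  + exact: sb_cong_refl.
  + exact: sb_cong_sym.
  + exact: sb_cong_trans IH1 IH2.
- elim: Hv => {u v v' Hu} [u x w w' Hw|w|w w' _ IH|w1 w2 w3 _ IH1 _ IH2].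
  + by rewrite !(catA u' u); apply: sb_cong_step.
  + exact: sb_cong_refl.
  + exact: sb_cong_sym.
  + exact: sb_cong_trans IH1 IH2.
Qed.

Definition sb_eqv n : rel (sb_word n) := fun u v => `[< sb_cong u v >].

Fact sb_eqv_refl n : reflexive (@sb_eqv n).
Proof. by move=> w; apply/asboolP; apply: sb_cong_refl. Qed.

Fact sb_eqv_sym n : symmetric (@sb_eqv n).
Proof. by move=> u v; apply/asboolP/asboolP; apply: sb_cong_sym. Qed.

Fact sb_eqv_trans n : transitive (@sb_eqv n).
Proof.
by move=> v u w /asboolP uv /asboolP vw; apply/asboolP; apply: sb_cong_trans vw.
Qed.

Canonical sb_equiv n :=
  EquivRel (@sb_eqv n) (@sb_eqv_refl n) (@sb_eqv_sym n) (@sb_eqv_trans n).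

Definition SBplus (n : nat) := {eq_quot (sb_equiv n)}.

HB.instance Definition _ n := Choice.on (SBplus n).
HB.instance Definition _ n := EqQuotient.on (SBplus n).

Lemma sb_piP n (u v : sb_word n) : \pi_(SBplus n) u = \pi_(SBplus n) v <-> sb_cong u v.
Proof.
by split=> [/eqmodP /asboolP //|uv]; apply/eqmodP/asboolP.
Qed.

Definition sb_one n : SBplus n := \pi_(SBplus n) [::].

Definition sb_mul n : SBplus n -> SBplus n -> SBplus n :=
  lift_op2 (SBplus n) (@cat (sb_gen n)).

Lemma sb_mul_pi n (u v : sb_word n) :
  sb_mul (\pi_(SBplus n) u) (\pi_(SBplus n) v) = \pi_(SBplus n) (u ++ v).
Proof.
by unlock sb_mul; apply/sb_piP; apply: sb_cong_cat; apply/sb_piP; rewrite reprK.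
Qed.

Fact sb_mulA n : associative (@sb_mul n).
Proof.
by elim/quotW=> u; elim/quotW=> v; elim/quotW=> w; rewrite !sb_mul_pi catA.
Qed.

Fact sb_mul1g n : left_id (@sb_one n) (@sb_mul n).
Proof. by elim/quotW=> u; rewrite sb_mul_pi. Qed.

Fact sb_mulg1 n : right_id (@sb_one n) (@sb_mul n).
Proof. by elim/quotW=> u; rewrite sb_mul_pi cats0. Qed.

HB.instance Definition _ n :=
  isMonoid.Build (SBplus n) (@sb_mulA n) (@sb_mul1g n) (@sb_mulg1 n).

Definition sb_length n (a : SBplus n) : nat := size (repr a).

(* Independence of the representative. *)
Lemma sb_length_pi n (w : sb_word n) : sb_length (\pi_(SBplus n) w) = size w.
Proof. by apply: sb_cong_size; apply/sb_piP; rewrite reprK. Qed.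

Local Open Scope classical_set_scope.

Definition sb_layer n k : set (SBplus n) := [set a | sb_length a = k].

Arguments sb_layer : clear implicits.

(* [fset_set] below is only meaningful on finite sets. *)
Lemma finite_sb_layer n k : finite_set (sb_layer n k).
Proof.
apply: (@sub_finite_set _ _
  [set \pi_(SBplus n) (tval t) | t in [set: k.-tuple (sb_gen n)]]).
  by move=> a /eqP ha; exists (Tuple ha) => //=; rewrite reprK.
by apply: finite_image; apply: finite_finset.
Qed.

Definition sb_count n k : nat := #|` fset_set (sb_layer n k) |%fset.

Local Open Scope ring_scope.

Definition sb_genfun n : nat -> rat := fun k => (sb_count n k)%:R.

(* A formal power series is given by its coefficients. That f is the expansion
   at 0 of p / q, where q does not vanish at 0, means q * f = p in rat[[t]]. *)
Definition is_rational_series (f : nat -> rat) : Prop :=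
  exists p q : {poly rat},
    q.[0] != 0 /\ forall k, \sum_(i < k.+1) q`_i * f (k - i)%N = p`_k.

(* Main.v *)
(* Every pair of generators heads at most one relation a p = b q, and this
   partial complement satisfies Dehornoy's cube condition. Since the relations
   preserve length, Garside's induction then shows that the monoid is left
   cancellative and that two elements with a common right multiple have a least
   one. If A(d, l) denotes the series counting the right multiples of d that are
   divisible by no generator in l, then A(d, a :: l) = A(d, l) - A(d v a, l), the
   last term being 0 when d and a have no common multiple, while
   A(d, [::]) = t^|d| f by cancellation. Hence A(1, all generators) = q f with q
   a polynomial, q(0) = 1; and this series is 1, as only 1 is divisible by no
   generator. *)
Require Import Defs.
From mathcomp Require Import all_boot all_order all_algebra.
From mathcomp Require Import zify.
From mathcomp Require Import finmap boolp classical_sets cardinality.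

Set Implicit Arguments.
Unset Strict Implicit.
Unset Printing Implicit Defensive.

Import GRing.Theory.

(** * Word reversing for a partial complement *)

Variant outcome (L : Type) := Timeout | Undef | Lcm of seq L & seq L.
Arguments Timeout {L}.
Arguments Undef {L}.

(** [Lcm r s] encodes a square u r = v s, pasted from a square a p = b q on the first letters and
    three recursive ones. Reversing may loop for a general complement, hence the fuel; [Undef]
    reports a pair of letters without complement. *)
Fixpoint rev_word (L : Type) (comp : L -> L -> option (seq L * seq L))
    (fuel : nat) (u v : seq L) : outcome L :=
  if fuel is f.+1 then
    match u, v with
    | [::], _ => Lcm v [::]
    | _, [::] => Lcm [::] u
    | a :: u', b :: v' =>
      if comp a b is Some (p, q) then
        match rev_word comp f u' p with
        | Lcm r1 s1 =>
          match rev_word comp f v' q with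
          | Lcm r2 s2 =>
            match rev_word comp f s1 s2 with
            | Lcm r3 s3 => Lcm (r1 ++ r3) (r2 ++ s3)
            | o => o
            end
          | o => o
          end
        | o => o
        end
      else Undef
    end
  else Timeout.

Definition map_outcome (L L' : Type) (h : L -> L') (o : outcome L) : outcome L' :=
  match o with
  | Timeout => Timeout
  | Undef => Undef
  | Lcm r s => Lcm (map h r) (map h s)
  end.

Definition map_pair (L L' : Type) (h : L -> L') (pq : seq L * seq L) :=
  (map h pq.1, map h pq.2).

(** Transports reversings computed on a few sample letters to arbitrary ones; [h] may identify
    letters, as happens when indices coincide. *)
Lemma rev_word_map (L L' : Type) (h : L -> L') comp comp' :
    (forall a b, comp' (h a) (h b) = omap (map_pair h) (comp a b)) ->
  forall f u v,
    rev_word comp' f (map h u) (map h v) = map_outcome h (rev_word comp f u v).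
Proof.
move=> hc; elim=> [//|f IH] [|a u] [|b v] //=.
rewrite hc; case: (comp a b) => [[p q]|] //=.
rewrite IH; case: (rev_word comp f u p) => [||r1 s1] //=.
rewrite IH; case: (rev_word comp f v q) => [||r2 s2] //=.
rewrite IH; case: (rev_word comp f s1 s2) => [||r3 s3] //=.
by rewrite !map_cat.
Qed.

(** * The complement of the singular braid relations and its finite cube check *)

Variant position := Same | Far | Adj.

(* Some (p, q) encodes the relation a p = b q; two singular generators with
   adjacent indices head no common relation. *)
Definition complement n (d : 'I_n.-1 -> 'I_n.-1 -> position) (a b : sb_gen n) :
    option (sb_word n * sb_word n) :=
  match a, b with
  | Sigma i, Sigma j =>
    match d i j with
    | Same => Some ([::], [::])
    | Far => Some ([:: b], [:: a])
    | Adj => Some ([:: b; a], [:: a; b])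
    end
  | Sing i, Sing j =>
    match d i j with
    | Same => Some ([::], [::])
    | Far => Some ([:: b], [:: a])
    | Adj => None
    end
  | Sigma i, Sing j =>
    match d i j with
    | Adj => Some ([:: Sigma j; Sing i], [:: Sigma i; Sigma j])
    | _ => Some ([:: b], [:: a])
    end
  | Sing i, Sigma j =>
    match d i j with
    | Adj => Some ([:: Sigma j; Sigma i], [:: Sigma i; Sing j])
    | _ => Some ([:: b], [:: a])
    end
  end.

(** Passing from [a] to [b] through [c] gives a p1 r = b q2 s, which must be a multiple of a p = b q
    by one common factor. An [Lcm] with empty second word certifies divisibility, and with both
    words empty, equality. *)
Definition cube_check n (d : 'I_n.-1 -> 'I_n.-1 -> position) (f : nat)
    (a b c : sb_gen n) : bool :=
  let comp := complement d in
  if (comp a c, comp c b) is (Some (p1, q1), Some (p2, q2)) then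
    match rev_word comp f q1 p2 with
    | Timeout => false
    | Undef => true
    | Lcm r s =>
      if comp a b is Some (p, q) then
        if (rev_word comp f p (p1 ++ r), rev_word comp f q (q2 ++ s))
          is (Lcm z [::], Lcm z' [::])
        then if rev_word comp f z z' is Lcm [::] [::] then true else false
        else false
      else false
    end
  else true.

Definition sb_letter n (t : bool) (i : 'I_n.-1) : sb_gen n :=
  if t then Sing i else Sigma i.

(* The indices 0, 1, 2 stand for arbitrary indices i, j, k, of which only the mutual
   positions matter. *)
Definition table (e01 e02 e12 : position) (x y : 'I_4.-1) : position :=
  match val x, val y with
  | 0, 1 | 1, 0 => e01
  | 0, 2 | 2, 0 => e02
  | 1, 2 | 2, 1 => e12
  | _, _ => Same
  end.

(** Excludes what three integers cannot do: be pairwise at distance 1, or be equal in one pair yet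
    positioned differently towards the third. *)
Definition consistent (e01 e02 e12 : position) : bool :=
  match e01, e02, e12 with
  | Adj, Adj, Adj => false
  | Same, Same, Same => true
  | Same, e, e' | e, Same, e' | e, e', Same =>
    match e, e' with Far, Far | Adj, Adj => true | _, _ => false end
  | _, _, _ => true
  end.

Definition i0 : 'I_4.-1 := @Ordinal 3 0 isT.
Definition i1 : 'I_4.-1 := @Ordinal 3 1 isT.
Definition i2 : 'I_4.-1 := @Ordinal 3 2 isT.

Lemma cube_check_table : exists f, forall e01 e02 e12 (t0 t1 t2 : bool),
  consistent e01 e02 e12 ->
  cube_check (table e01 e02 e12) f
    (sb_letter t0 i0) (sb_letter t1 i1) (sb_letter t2 i2).
Proof.
(* A fuel of [20] lets every reversing in these finitely many cases finish. *)
exists 20 => e01 e02 e12 t0 t1 t2.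
by case: e01; case: e02; case: e12 => // _; case: t0; case: t1; case: t2;
  vm_compute.
Qed.

(** * Complement and reversing inside the monoid *)

Section PositiveSingularBraids.
Variable n : nat.
Implicit Types (i j k : 'I_n.-1) (a b c : sb_gen n) (p q u v w : sb_word n).
Implicit Types (x y z m : SBplus n).

Local Notation pi u := (\pi_(SBplus n)%qT u).
Local Open Scope group_scope.

Definition index_position i j : position :=
  if i == j then Same else if `|i - j|%N == 1%N then Adj else Far.

Local Notation comp := (complement index_position).
Local Notation rev := (rev_word comp).

Lemma pi_cat u v : pi (u ++ v) = pi u * pi v.
Proof. by rewrite -[RHS]/(sb_mul _ _) sb_mul_pi. Qed.

Lemma pi_cons a u : pi (a :: u) = pi [:: a] * pi u.
Proof. by rewrite -pi_cat. Qed.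

Lemma pi_nil : pi [::] = 1.
Proof. by []. Qed.

Lemma sb_lengthM x y : sb_length (x * y) = (sb_length x + sb_length y)%N.
Proof.
by rewrite -[x]reprK -[y]reprK -pi_cat !sb_length_pi size_cat.
Qed.

Lemma sb_length1 : sb_length (1 : SBplus n) = 0%N.
Proof. by rewrite -pi_nil sb_length_pi. Qed.

Lemma sb_rel_complement w w' : sb_rel w w' ->
  exists a b p q, [/\ w = a :: p, w' = b :: q & comp a b = Some (p, q)].
Proof.
have neq i j : `|i - j|%N != 0%N -> (i == j) = false.
  by move=> h; apply/negP => /eqP ij; rewrite ij in h; lia.
have far i j : (1%N < `|i - j|)%N -> index_position i j = Far.
  by move=> h; rewrite /index_position neq ?ifN //; lia.
have adj i j : j = i.+1 :> nat -> index_position i j = Adj /\ index_position j i = Adj.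
  by move=> h; rewrite /index_position !neq ?ifT //; lia.
case=> i j h; do 4 eexists; (split; [reflexivity | reflexivity |]) => /=.
- by rewrite far.
- by rewrite far.
- by rewrite /index_position (negPf h); case: eqP.
- by have [-> _] := adj _ _ h.
- by have [-> _] := adj _ _ h.
- by have [_ ->] := adj _ _ h.
Qed.

Lemma complementC a b :
  comp b a = omap (fun pq => (pq.2, pq.1)) (comp a b).
Proof.
have sym i j : index_position i j = index_position j i.
  by rewrite /index_position eq_sym distnC.
by case: a b => i [] j /=; rewrite sym; case: (index_position i j).
Qed.

Lemma complementxx a : comp a a = Some ([::], [::]).
Proof. by case: a => i /=; rewrite /index_position eqxx. Qed.

Lemma pi_rel w w' : sb_rel w w' -> pi w = pi w'.
Proof.
move=> h; apply/sb_piP; have := sb_cong_step [::] [::] h.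
by rewrite /= !cats0.
Qed.

Lemma complement_eq a b p q :
  comp a b = Some (p, q) -> pi (a :: p) = pi (b :: q).
Proof.
have adj i j : index_position i j = Adj -> j = i.+1 :> nat \/ i = j.+1 :> nat.
  by rewrite /index_position; case: eqP => // _; case: eqP => // h _; lia.
have same i j : index_position i j = Same -> i = j.
  by rewrite /index_position; case: eqP => // _; case: ifP.
have far i j : index_position i j = Far -> (1%N < `|i - j|)%N.
  rewrite /index_position; case: (eqVneq i j) => // ne; case: eqP => // h _.
  by move/eqP: ne => ne; have : (i : nat) <> j by [move/val_inj]; lia.
case: a b => i [] j /=; case E: (index_position i j) => //.
all: move=> [<- <-].
all: try by rewrite (same _ _ E).
all: try by apply: pi_rel; constructor; apply: far.
all: try by apply/esym/pi_rel; constructor; apply: far.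
- by case: (adj _ _ E) => h; [|symmetry]; apply: pi_rel; constructor.
- by rewrite (same _ _ E); apply/esym/pi_rel; constructor; rewrite distnn.
- by apply/esym/pi_rel; constructor; have := far _ _ E; rewrite distnC; lia.
- by case: (adj _ _ E) => h; apply: pi_rel; constructor.
- by rewrite (same _ _ E); apply/pi_rel; constructor; rewrite distnn.
- by apply/pi_rel; constructor; have := far _ _ E; lia.
- by case: (adj _ _ E) => h; apply/esym/pi_rel; constructor.
Qed.

Lemma rev_word_eq f u v r s :
  rev f u v = Lcm r s -> pi u * pi r = pi v * pi s.
Proof.
elim: f u v r s => [//|f IH] [|a u] [|b v] r s /=.
- by move=> [<- <-].
- by move=> [<- <-]; rewrite pi_nil mul1g mulg1.
- by move=> [<- <-]; rewrite pi_nil mul1g mulg1.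
case E: (comp a b) => [[p q]|] //.
case E1: (rev f u p) => [||r1 s1] //; case E2: (rev f v q) => [||r2 s2] //.
case E3: (rev f s1 s2) => [||r3 s3] // [<- <-].
rewrite !pi_cat [pi (a :: u)]pi_cons [pi (b :: v)]pi_cons.
rewrite -!mulgA [pi u * _]mulgA [pi v * _]mulgA (IH _ _ _ _ E1) (IH _ _ _ _ E2).
rewrite -!mulgA (IH _ _ _ _ E3) !mulgA -!pi_cons.
by rewrite (complement_eq E).
Qed.

(** * The cube condition for arbitrary indices *)

Lemma index_position_consistent i j k :
  consistent (index_position i j) (index_position i k) (index_position j k).
Proof.
have E : forall i j, index_position i j =
    if (i : nat) == j then Same else if `|i - j|%N == 1%N then Adj else Far by [].
rewrite !E; move: (i : nat) (j : nat) (k : nat) => {}i {}j {}k.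
do 3 (case: eqP => ?; [|case: eqP => ?]) => //=; lia.
Qed.

Definition cube_closes (o : outcome (sb_gen n)) (p1 q2 : sb_word n) a b : Prop :=
  match o with
  | Timeout => False
  | Undef => True
  | Lcm r s =>
    exists p q z, [/\ comp a b = Some (p, q), pi p1 * pi r = pi p * z
                    & pi q2 * pi s = pi q * z]
  end.

Lemma cube_check_map n' (d : 'I_n'.-1 -> 'I_n'.-1 -> position)
    (h : sb_gen n' -> sb_gen n) f (a b c : sb_gen n') p1 q1 p2 q2 :
    (forall g g', comp (h g) (h g') = omap (map_pair h) (complement d g g')) ->
    cube_check d f a b c ->
    comp (h a) (h c) = Some (p1, q1) -> comp (h c) (h b) = Some (p2, q2) ->
  cube_closes (rev f q1 p2) p1 q2 (h a) (h b).
Proof.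
move=> hE; have rE := rev_word_map hE; rewrite /cube_check /cube_closes !hE.
case: (complement d a c) => [[p1' q1']|] //=.
case: (complement d c b) => [[p2' q2']|] //= + [<- <-] [<- <-].
rewrite rE; case: (rev_word _ f q1' p2') => [||r' s'] //=.
case: (complement d a b) => [[p' q']|] //=.
case E1: (rev_word _ _ p' _) => [||z [|//]] //.
case E2: (rev_word _ _ q' _) => [||z' [|//]] //.
case E3: (rev_word _ _ z z') => [||[|//] [|//]] // _.
have := rE f p' (p1' ++ r'); rewrite E1 /= => /rev_word_eq.
have := rE f q' (q2' ++ s'); rewrite E2 /= => /rev_word_eq.
have := rE f z z'; rewrite E3 /= => /rev_word_eq.
rewrite !map_cat !pi_cat pi_nil !mulg1 => zz' e2 e1.
exists (map h p'), (map h q'), (pi (map h z')).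
by rewrite e2 -zz' e1.
Qed.

(** Three letters involve at most three indices, and the complement sees only their mutual
    positions, so the finite table covers every case. *)
Lemma cube_condition : exists f, forall a b c p1 q1 p2 q2,
    comp a c = Some (p1, q1) -> comp c b = Some (p2, q2) ->
  cube_closes (rev f q1 p2) p1 q2 a b.
Proof.
have [f check] := cube_check_table; exists f => a b c p1 q1 p2 q2.
have letter g : exists t i, g = sb_letter t i.
  by case: g => i; [exists false|exists true]; exists i.
have [ta [i ->]] := letter a; have [tb [j ->]] := letter b.
have [tc [k ->]] := letter c.
pose ph (x : 'I_4.-1) := nth i [:: i; j; k] x.
pose h (g : sb_gen 4) : sb_gen n :=
  match g with Sing x => Sing (ph x) | Sigma x => Sigma (ph x) end.
pose d := table (index_position i j) (index_position i k) (index_position j k).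
have dE (x y : 'I_4.-1) : index_position (ph x) (ph y) = d x y.
  have sym l l' : index_position l l' = index_position l' l.
    by rewrite /index_position eq_sym distnC.
  have xx l : index_position l l = Same by rewrite /index_position eqxx.
  rewrite /d /table /ph.
  by case: x => [[|[|[|//]]] ?]; case: y => [[|[|[|//]]] ?];
    rewrite /= ?xx // sym.
have hE g g' : comp (h g) (h g') = omap (map_pair h) (complement d g g').
  by case: g => x; case: g' => y /=; rewrite dE; case: (d x y).
have hl t (x : 'I_4.-1) : sb_letter t (ph x) = h (sb_letter t x) by case: t.
have := check _ _ _ ta tb tc (index_position_consistent i j k).
rewrite -/d => /(cube_check_map hE).
by rewrite -!hl; apply.
Qed.

(** * Garside's induction on length *)

Definition letters_reduce N := forall a b x y,
    (sb_length x < N)%N -> pi [:: a] * x = pi [:: b] * y ->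
  exists p q z, [/\ comp a b = Some (p, q), x = pi p * z & y = pi q * z].

(** Completeness of reversing: a given common multiple rules out [Undef] and factors through the
    computed one. Each recursive call concerns a common multiple shorter by at least one letter, so
    fuel above the length of the first one rules out [Timeout]. *)
Lemma rev_word_factor N f u v x y :
    letters_reduce N -> (size u + sb_length x <= N)%N ->
    pi u * x = pi v * y ->
  match rev f u v with
  | Timeout => is_true (f <= size u + sb_length x)%N
  | Undef => False
  | Lcm r s => exists z, x = pi r * z /\ y = pi s * z
  end.
Proof.
move=> red; elim: f u v x y => [//|f IH] [|a u] [|b v] x y /=.
- by rewrite pi_nil !mul1g => _ ->; exists y; rewrite mul1g.
- by rewrite pi_nil !mul1g => _ ->; exists y; rewrite mul1g.
- by rewrite pi_nil !mul1g => _ <-; exists x; rewrite mul1g.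
rewrite addSn pi_cons (pi_cons b) -!mulgA => leN e.
have [|p [q [z [-> ux vy]]]] := red a b _ _ _ e.
  by rewrite sb_lengthM sb_length_pi.
have := IH u p x z (ltnW leN) ux.
case: (rev f u p) => [||r1 s1] //= [z1 [xr zs]].
have lenz : (size u + sb_length x = size p + sb_length z)%N.
  by have := congr1 (@sb_length n) ux; rewrite !sb_lengthM !sb_length_pi.
have lenv : (size u + sb_length x = size v + sb_length y)%N.
  have := congr1 (@sb_length n) e.
  by rewrite !sb_lengthM !sb_length_pi /= !add1n => -[].
have := IH v q y z; rewrite -lenv => /(_ (ltnW leN) vy).
case: (rev f v q) => [||r2 s2] //= [z2 [yr zs2]].
have lenz1 : (sb_length z = size s1 + sb_length z1)%N.
  by rewrite zs sb_lengthM sb_length_pi.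
have := IH s1 s2 z1 z2; rewrite -zs -zs2 -lenz1.
have lez : (sb_length z <= size u + sb_length x)%N by rewrite lenz leq_addl.
move=> /(_ (leq_trans lez (ltnW leN)) erefl).
case: (rev f s1 s2) => [le_f||r3 s3] //=.
  by rewrite ltnS (leq_trans le_f).
by move=> [z3 [z1E z2E]]; exists z3; rewrite !pi_cat xr yr z1E z2E !mulgA.
Qed.

(** The outer induction on length makes reversing complete on shorter words; the inner one follows
    the derivation of the congruence, whose transitivity case needs the cube condition. *)
Lemma letters_reduceP N : letters_reduce N.
Proof.
elim: N => [//|N IH].
pose factor w w' := forall a b u v, w = a :: u -> w' = b :: v ->
  exists p q z, [/\ comp a b = Some (p, q), pi u = pi p * z & pi v = pi q * z].
suff H w w' : sb_cong w w' -> (size w <= N.+1)%N -> factor w w'.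
  move=> a b x y lex e.
  have /sb_piP c : pi (a :: repr x) = pi (b :: repr y).
    by rewrite pi_cons (pi_cons b) !reprK.
  have := H _ _ c lex a b _ _ erefl erefl.
  by rewrite !reprK.
(* A single rewriting step changes the first letter only if nothing precedes the relation, whence
   the split on [[|d u]]. *)
elim=> {w w'} [[|d u] v w w' h _|w _|w w' h IHw sz|w1 w2 w3 h1 IH1 h2 IH2 sz].
- have [a [b [p [q [-> -> e]]]]] := sb_rel_complement h.
  move=> a' b' u' v' /= [<- <-] [<- <-]; exists p, q, (pi v).
  by rewrite !pi_cat.
- move=> a b u' v' /= [<- <-] [<- <-]; exists [::], [::], (pi (u ++ w ++ v)).
  rewrite complementxx !mul1g; split=> //.
  by rewrite !pi_cat (pi_rel h).
- move=> a b u v -> [<- <-]; exists [::], [::], (pi u).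
  by rewrite complementxx !mul1g.
- move=> a b u v eu ev; rewrite -(sb_cong_size h) in sz.
  have [p [q [z [e1 e2 e3]]]] := IHw sz _ _ _ _ ev eu.
  by exists q, p, z; rewrite complementC e1.
- have sz2 := sz; rewrite (sb_cong_size h1) in sz2.
  move=> a b u v eu ev; case: w2 => [|c w2] in h1 IH1 h2 IH2 sz2 *.
    by have := sb_cong_size h1; rewrite eu.
  have [p1 [q1 [z1 [c1 uE wE]]]] := IH1 sz _ _ _ _ eu erefl.
  have [p2 [q2 [z2 [c2 wE2 vE]]]] := IH2 sz2 _ _ _ _ erefl ev.
  have [f cube] := cube_condition.
  have := cube _ _ _ _ _ _ _ c1 c2.
  (* Both factorizations of w2 share a common multiple, so reversing q1 and p2
     is defined, and the cube condition turns it into one of a and b. *)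
  have le : (size q1 + sb_length z1 <= N)%N.
    by have := congr1 (@sb_length n) wE; rewrite sb_lengthM !sb_length_pi => <-.
  have := rev_word_factor f IH le (etrans (esym wE) wE2).
  case: (rev f q1 p2) => [||r s] //= [z [z1E z2E]] [p [q [y [e pE qE]]]].
  exists p, q, (y * z); split=> //.
    by rewrite uE z1E !mulgA pE.
  by rewrite vE z2E !mulgA qE.
Qed.

(** * Left cancellation and least common multiples *)

(** Letters are removed one at a time by [letters_reduceP] with equal letters, whose complement is a
    pair of empty words. *)
Lemma sb_mulgI x y z : x * y = x * z -> y = z.
Proof.
rewrite -[x]reprK; elim: (repr x) => [|a u IH]; first by rewrite pi_nil !mul1g.
rewrite pi_cons -!mulgA.
move=> /(letters_reduceP (leqnn _)) [p [q [t [+ e1 e2]]]].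
by rewrite complementxx => -[ep eq]; apply: IH; rewrite e1 e2 -ep -eq.
Qed.

Definition divides x y := exists z, y = x * z.

(** Reversing depends only on representatives of [x] and [y], so the square found thanks to [m]
    divides every other common multiple [m'] as well. *)
Lemma divides_lcm x y m : divides x m -> divides y m ->
  exists d, divides x d /\ forall m', divides d m' <-> divides x m' /\ divides y m'.
Proof.
move=> [x' mx] [y' my].
have e : pi (repr x) * x' = pi (repr y) * y' by rewrite !reprK -mx.
(* One more than the length of [m], which excludes [Timeout]. *)
set f := (size (repr x) + sb_length x').+1.
have := rev_word_factor f (@letters_reduceP _) (leqnn _) e.
case E: (rev f _ _) => [||r s] //=; first by rewrite ltnn.
have := rev_word_eq E; rewrite !reprK => xr _.
exists (x * pi r); split; first by exists (pi r).
move=> m'; split=> [[z ->]|[[z m'x] [t m'y]]].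
  split; first by exists (pi r * z); rewrite mulgA.
  by exists (pi s * z); rewrite xr mulgA.
have e' : pi (repr x) * z = pi (repr y) * t by rewrite !reprK -m'x.
have := rev_word_factor f (@letters_reduceP _) (leqnn _) e'.
by rewrite E => -[z' [z'E _]]; exists z'; rewrite m'x z'E mulgA.
Qed.
End PositiveSingularBraids.

(** * Counting multiples and inclusion-exclusion *)

Section Counting.
Variable n : nat.
Implicit Types (a : sb_gen n) (l : seq (sb_gen n)) (d x y m : SBplus n).
Implicit Types (A B : set (SBplus n)).

Local Notation pi u := (\pi_(SBplus n)%qT u).
Local Open Scope classical_set_scope.

Definition layer_card A k : nat := #|` fset_set (sb_layer n k `&` A) |%fset.

Lemma finite_layerI A k : finite_set (sb_layer n k `&` A).
Proof. exact: sub_finite_set (@subIsetl _ _ _) (finite_sb_layer n k). Qed.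

Lemma layer_cardID A B k :
  layer_card A k = (layer_card (A `&` B) k + layer_card (A `\` B) k)%N.
Proof.
rewrite /layer_card setIIr setIDA.
rewrite (_ : (_ `&` A) `\` B = (sb_layer n k `&` A) `\` (sb_layer n k `&` B)).
  by rewrite fset_setD ?(fset_setI (A := _ `&` A)) ?cardfsID //; exact: finite_layerI.
by apply/seteqP; split=> m /=; tauto.
Qed.

(** By left cancellation, multiplication by [d] is injective and shifts lengths by that of [d]. *)
Lemma layer_card_divides d k :
  layer_card [set m | divides d m] k =
  if (sb_length d <= k)%N then sb_count n (k - sb_length d) else 0%N.
Proof.
case: leqP => h; last first.
  rewrite /layer_card (_ : _ `&` _ = set0) ?fset_set0 ?cardfs0 //.
  apply/seteqP; split=> // m [/= mk [z mz]].
  by move: mk; rewrite /sb_layer /= mz sb_lengthM => mk; lia.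
rewrite /layer_card /sb_count.
rewrite (_ : _ `&` _ = (fun z => d * z)%g @` sb_layer n (k - sb_length d)).
  rewrite fset_set_image ?card_imfset //.
    exact: sb_mulgI.
  exact: finite_sb_layer.
apply/seteqP; split=> m /=.
- move=> [mk [z mz]]; exists z => //; move: mk.
  by rewrite /sb_layer /= mz sb_lengthM; lia.
- move=> [z zk <-]; split; last by exists z.
  by move: zk; rewrite /sb_layer /= sb_lengthM; lia.
Qed.

Definition avoiding d l : set (SBplus n) :=
  [set m | divides d m /\ forall a, a \in l -> ~ divides (pi [:: a]) m].

Local Open Scope ring_scope.

Definition series_mul (g : {poly rat}) (f : nat -> rat) (k : nat) : rat :=
  \sum_(i < k.+1) g`_i * f (k - i)%N.

(** The constant coefficient is tracked through the induction because it makes the final denominator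
    nonzero at 0. *)
Lemma avoiding_series d l : exists g : {poly rat},
  g`_0 = (sb_length d == 0%N)%:R /\
  forall k, (layer_card (avoiding d l) k)%:R = series_mul g (sb_genfun n) k.
Proof.
elim: l d => [|a l IH] d.
  exists ('X^(sb_length d)); rewrite coefXn eq_sym; split=> // k.
  rewrite (_ : avoiding d [::] = [set m | divides d m]); last first.
    by apply/seteqP; split=> m /=; [case|split].
  rewrite layer_card_divides /series_mul.
  case: leqP => h.
    rewrite (bigD1 (Ordinal (h : (sb_length d < k.+1)%N))) //= coefXn eqxx mul1r.
    rewrite big1 ?addr0 // => i; rewrite -val_eqE coefXn /= => /negPf ->.
    by rewrite mul0r.
  rewrite big1 // => i _; rewrite coefXn; case: eqP => [e|]; last by rewrite mul0r.
  by have := ltn_ord i; lia.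
have [g [g0 gE]] := IH d.
have split_a k := layer_cardID (avoiding d l) [set m | divides (pi [:: a]) m] k.
have dropE : avoiding d l `\` [set m | divides (pi [:: a]) m] = avoiding d (a :: l).
  apply/seteqP; split=> m /=.
  - move=> [[dm nl] na]; split=> // b; rewrite inE => /orP [/eqP -> //|].
    exact: nl.
  - move=> [dm nl]; split; last by apply: nl; rewrite inE eqxx.
    by split=> // b bl; apply: nl; rewrite inE bl orbT.
case: (pselect (exists m, divides d m /\ divides (pi [:: a]) m)) => [[m [dm am]]|no].
- have [e [_ eP]] := divides_lcm dm am.
  have [h [h0 hE]] := IH e.
  have keepE : avoiding d l `&` [set m | divides (pi [:: a]) m] = avoiding e l.
    apply/seteqP; split=> m' /=.
    + by move=> [[dm' nl] am']; split=> //; apply/eP.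
    + by move=> [/eP [dm' am'] nl].
  (* The multiple [e] of the generator [a] has positive length, so subtracting [h] keeps the
     constant coefficient. *)
  have e_neq0 : sb_length e != 0%N.
    have /eP [_ [z ->]] : divides e e by exists 1%g; rewrite mulg1.
    by rewrite sb_lengthM sb_length_pi.
  exists (g - h); rewrite coefB g0 h0 (negPf e_neq0) subr0; split=> // k.
  have := split_a k; rewrite keepE dropE => /(congr1 (fun c => c%:R : rat)).
  rewrite natrD gE hE => /eqP; rewrite addrC -subr_eq => /eqP <-.
  rewrite /series_mul -sumrB; apply: eq_bigr => i _.
  by rewrite coefB mulrBl.
- exists g; split=> // k; rewrite -gE split_a dropE.
  rewrite (_ : _ `&` _ = set0); last first.
    by apply/seteqP; split=> // m /= [[dm _] am]; apply: no; exists m.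
  by rewrite /layer_card setI0 fset_set0 cardfs0.
Qed.

Lemma layer_card_avoiding_all k :
  layer_card (avoiding 1%g (enum {: sb_gen n})) k = (k == 0%N).
Proof.
have not_divisible m : (forall a, ~ divides (pi [:: a]) m) -> m = 1%g.
  rewrite -[m]reprK; case: (repr m) => [//|a u] no; case: (no a).
  by exists (pi u); rewrite -pi_cat.
rewrite /layer_card (_ : _ `&` _ = if k == 0%N then [set 1%g] else set0).
  by case: eqP => _; rewrite ?fset_set1 ?cardfs1 ?fset_set0 ?cardfs0.
apply/seteqP; split=> m.
- move=> [mk [_ no]]; have m1 : m = 1%g.
    by apply: not_divisible => a; apply: no; rewrite mem_enum.
  by move: mk; rewrite m1 /sb_layer /= sb_length1 => <-.
- case: eqP => // -> /= ->; split; first exact: sb_length1.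
  split; first by exists 1%g; rewrite mulg1.
  move=> a _ [z /(congr1 (@sb_length n))].
  by rewrite sb_lengthM sb_length_pi sb_length1.
Qed.

End Counting.

Theorem theorem2p1 (n : nat) (n_gt0 : (0 < n)%N) :
  is_rational_series (sb_genfun n).
Proof.
have [q [q0 qE]] := avoiding_series (1%g : SBplus n) (enum {: sb_gen n}).
exists 1%R, q; split=> [|k].
  by rewrite horner_coef0 q0 sb_length1 eqxx oner_eq0.
by rewrite -[LHS]/(series_mul q (sb_genfun n) k) -qE layer_card_avoiding_all coef1.
Qed.
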